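(* Let $a_1,\dots,a_m\in\mathbb{R}^d$, a convex polytope $\mathcal{P}\subseteq\mathbb{R}^d$, $\epsilon>0$, $b_{\max}>0$ and a database $D=(b_1,\dots,b_m)\in\mathbb{R}^m$ be given. Let $f(x,D)=\max_{i=1,\dots,m}\{a_i^Tx+b_i\}$ and $f_{\mathrm{opt}}=\min_{x\in\mathcal{P}}f(x,D)$, and assume $0<\int_{x\in\mathcal{P}}\exp(-\epsilon f(x,D)/(2b_{\max}))\,dx<\infty$. Let $M_E(D)$ be a random point of $\mathcal{P}$ with probability density proportional to $\exp(-\epsilon f(x,D)/(2b_{\max}))$, $x\in\mathcal{P}$. Then $$\mathbb{E}\big[f(M_E(D),D)-f_{\mathrm{opt}}\big]\le C(0,\epsilon)\cdot\frac{2b_{\max}}{\epsilon},$$ where for any $\gamma\ge 0$ $$C(\gamma,\epsilon)=\frac{\exp(-\epsilon f_{\mathrm{opt}}/(2b_{\max}))\int_{x\in\mathcal{P}:\, f(x,D)\ge f_{\mathrm{opt}}+\gamma}dx}{\int_{x\in\mathcal{P}}\exp(-\epsilon f(x,D)/(2b_{\max}))\,dx}.$$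
   Context: A polytope here means a set defined by finitely many linear inequalities. The minimum $f_{\mathrm{opt}}$ is assumed to be attained. $C(\gamma,\epsilon)$ is allowed to take the value $+\infty$ (if $\mathcal{P}$ has infinite volume), in which case the bound is vacuous. *)

(* Defs.v *)
From HB Require Import structures.
From mathcomp Require Import all_boot all_order all_algebra.
From mathcomp Require Import all_classical all_reals all_analysis.

Set Implicit Arguments.
Unset Strict Implicit.
Unset Printing Implicit Defensive.

Import Order.TTheory GRing.Theory Num.Theory.
Import numFieldNormedType.Exports.

Local Open Scope classical_set_scope.
Local Open Scope ring_scope.

(* Points of R^d are [d.-tuple R], which the library equips with the product
   sigma-algebra. The library has no Lebesgue measure on this type, so it is
   built here by recursion on the dimension, as an iterated product of the
   one-dimensional Lebesgue measure. *)
Section lebesgue_tuple.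
Context {R : realType}.

Section step.
Context {n : nat} (mu : {sigma_finite_measure set (n.-tuple R) -> \bar R}).

Definition tcons (p : measurableTypeR R * n.-tuple R) : n.+1.-tuple R :=
  [tuple of p.1 :: p.2].

Lemma measurable_tcons : measurable_fun setT tcons.
Proof. exact: measurable_cons. Qed.

Definition lebesgue_tupleS : set (n.+1.-tuple R) -> \bar R :=
  pushforward (lebesgue_measure \x mu)%E tcons.

Let lebesgue_tupleS0 : lebesgue_tupleS set0 = 0%E.
Proof. by rewrite /lebesgue_tupleS /pushforward preimage_set0 measure0. Qed.

Let lebesgue_tupleS_ge0 A : (0 <= lebesgue_tupleS A)%E.
Proof. by rewrite /lebesgue_tupleS /pushforward measure_ge0. Qed.

Let lebesgue_tupleS_sigma_additive : semi_sigma_additive lebesgue_tupleS.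
Proof.
move=> F mF tF mUF; rewrite /lebesgue_tupleS /pushforward preimage_bigcup.
apply: measure_semi_sigma_additive.
- by move=> i; rewrite -[X in measurable X]setTI; exact: measurable_tcons.
- apply/trivIsetP => /= i j _ _ ij; rewrite -preimage_setI.
  by move/trivIsetP : tF => /(_ _ _ _ _ ij) ->//; rewrite preimage_set0.
- by rewrite -preimage_bigcup -[X in measurable X]setTI; exact: measurable_tcons.
Qed.

HB.instance Definition _ := isMeasure.Build _ _ _ lebesgue_tupleS
  lebesgue_tupleS0 lebesgue_tupleS_ge0 lebesgue_tupleS_sigma_additive.

Let lebesgue_tupleS_sigma_finite : sigma_finite setT lebesgue_tupleS.
Proof.
have /sigma_finiteP[F [TF ndF Foo]] := sigma_finiteT (@lebesgue_measure R).
have /sigma_finiteP[G [TG ndG Goo]] := sigma_finiteT mu.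
pose g (x : n.+1.-tuple R) : measurableTypeR R * n.-tuple R :=
  (thead x, [tuple of behead x]).
have mg : measurable_fun setT g.
  apply/measurable_fun_pairP; split; last exact: measurable_behead.
  exact: (@measurable_tnth _ (measurableTypeR R)).
have gK : cancel tcons g by case=> a t; congr pair; apply/val_inj.
exists (fun k => g @^-1` (F k `*` G k)).
  apply/esym; rewrite -subTset => x _.
  have [i _ Fi] : (\bigcup_k F k) (g x).1 by rewrite -TF.
  have [j _ Gj] : (\bigcup_k G k) (g x).2 by rewrite -TG.
  exists (maxn i j) => //; split.
  - by apply: subsetPset Fi; exact/ndF/leq_maxl.
  - by apply: subsetPset Gj; exact/ndG/leq_maxr.
move=> k; have [mF Fk] := Foo k; have [mG Gk] := Goo k; split.
  by rewrite -[X in measurable X]setTI; apply: mg => //; exact: measurableX.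
rewrite /lebesgue_tupleS /pushforward -comp_preimage.
rewrite (_ : g \o tcons = id); last by apply/funext => p /=; rewrite gK.
by rewrite product_measure1E// lte_mul_pinfty// ge0_fin_numE.
Qed.

HB.instance Definition _ := Measure_isSigmaFinite.Build _ _ _ lebesgue_tupleS
  lebesgue_tupleS_sigma_finite.

End step.

Fixpoint lebesgue_tuple (n : nat) :
    {sigma_finite_measure set (n.-tuple R) -> \bar R} :=
  match n with
  | 0 => \d_[tuple]
  | n'.+1 => lebesgue_tupleS (lebesgue_tuple n')
  end.

Lemma lebesgue_tuple_box (n : nat) (A : 'I_n -> set (measurableTypeR R)) :
  (forall i, measurable (A i)) ->
  lebesgue_tuple n [set x | forall i, A i (tnth x i)] =
  (\prod_(i < n) lebesgue_measure (A i))%E.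
Proof.
elim: n A => [|n IHn] A mA.
  rewrite big_ord0 /= diracE.
  by rewrite (_ : _ \in _ = true)//; apply/mem_set => -[].
rewrite big_ord_recl -IHn//=.
rewrite /lebesgue_tupleS /pushforward -product_measure1E//; last first.
  rewrite (_ : [set _ | _] =
      \bigcap_(i in [set: 'I_n]) ((@tnth n R ^~ i) @^-1` A (lift ord0 i))).
    apply: fin_bigcap_measurable; first exact: finite_finset.
    move=> i _; rewrite -[X in measurable X]setTI.
    exact: (@measurable_tnth _ (measurableTypeR R)).
  by apply/seteqP; split => x /= h i; [move=> _|]; exact: h.
congr product_measure1; apply/seteqP; split => -[a t] /=.
  move=> h; split=> [|i]; first exact: (h ord0).
  by have := h (lift ord0 i); rewrite tnthS.
move=> [h0 h] i; have [j ->|->//] := unliftP ord0 i.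
by rewrite tnthS; exact: h.
Qed.

End lebesgue_tuple.

Section exponential_mechanism.
Context {R : realType} {d : nat}.

Definition dotp (u x : d.-tuple R) : R := \sum_(j < d) tnth u j * tnth x j.

Definition polytope (P : set (d.-tuple R)) : Prop :=
  exists (k : nat) (c : 'I_k -> d.-tuple R) (e : 'I_k -> R),
    P = [set x | forall i, dotp (c i) x <= e i].

(* The family is indexed by ['I_m.+1], hence nonempty: the default value of the
   big operator is one of the terms, so this is the usual maximum. *)
Definition maxaff (m : nat) (a : 'I_m.+1 -> d.-tuple R) (x : d.-tuple R)
    (D : m.+1.-tuple R) : R :=
  let l i := dotp (a i) x + tnth D i in
  \big[Num.max/l ord0]_(i < m.+1) l i.

Definition is_min (P : set (d.-tuple R)) (g : d.-tuple R -> R) (v : R) : Prop :=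
  (exists2 x, P x & g x = v) /\ (forall x, P x -> v <= g x).

Definition weight (eps bmax : R) (g : d.-tuple R -> R) (x : d.-tuple R) : R :=
  expR (- (eps * g x / (2 * bmax))).

Definition normalizer (P : set (d.-tuple R)) (eps bmax : R)
    (g : d.-tuple R -> R) : \bar R :=
  (\int[lebesgue_tuple d]_(x in P) (weight eps bmax g x)%:E)%E.

Definition has_density (disp : measure_display) (T : measurableType disp)
    (Pr : probability T R) (X : {RV Pr >-> d.-tuple R})
    (p : d.-tuple R -> R) : Prop :=
  [/\ measurable_fun setT p,
      forall x, 0 <= p x
    & forall A, measurable A ->
        distribution Pr X A = (\int[lebesgue_tuple d]_(x in A) (p x)%:E)%E].

(* The constant is forced to be the inverse of [normalizer], and X is in P
   almost surely because the density vanishes outside P. *)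
Definition exponential_mechanism (disp : measure_display)
    (T : measurableType disp) (Pr : probability T R)
    (X : {RV Pr >-> d.-tuple R}) (P : set (d.-tuple R)) (eps bmax : R)
    (g : d.-tuple R -> R) : Prop :=
  exists c : R, has_density X (fun x => c * weight eps bmax g x * \1_P x).

(* Extended-real valued: +oo is allowed when P has infinite volume. The inverse
   of an extended real is the usual one on positive finite values. *)
Definition Cgap (P : set (d.-tuple R)) (eps bmax : R) (g : d.-tuple R -> R)
    (gopt gamma : R) : \bar R :=
  ((expR (- (eps * gopt / (2 * bmax))))%:E *
   (\int[lebesgue_tuple d]_(x in P `&` [set x | (gopt + gamma <= g x)%R]) 1) /
   normalizer P eps bmax g)%E.

End exponential_mechanism.

(* Main.v *)
Require Import Defs.
From HB Require Import structures.
From mathcomp Require Import all_boot all_order all_algebra.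
From mathcomp Require Import all_classical all_reals all_analysis.
From mathcomp Require Import measurable_realfun ring.

Set Implicit Arguments.
Unset Strict Implicit.
Unset Printing Implicit Defensive.

Import Order.TTheory GRing.Theory Num.Theory.
Import numFieldNormedType.Exports.

Local Open Scope classical_set_scope.
Local Open Scope ring_scope.

(* With [k := 2 * bmax / eps] and [u := (f x - fopt) / k], the inequality
   [u * expR (- u) <= 1] bounds the gap times the weight pointwise:
   [(f x - fopt) * expR (- f x / k) <= k * expR (- fopt / k)]. Integrating over
   P against the density, whose constant is the inverse of the normalizer, gives
   the theorem, since for [gamma = 0] the integral in [Cgap] is the volume of
   P. *)

(* [p] is almost everywhere the Radon-Nikodym derivative of [nu], so the change
   of variables formula for that derivative applies. *)
Lemma ge0_integral_density (disp : measure_display) (T : measurableType disp)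
    (R : realType) (mu : {sigma_finite_measure set T -> \bar R})
    (nu : {finite_measure set T -> \bar R}) (p : T -> R) (f : T -> \bar R) :
  measurable_fun setT p -> (forall x, 0 <= p x) ->
  (forall A, measurable A -> nu A = \int[mu]_(x in A) (p x)%:E)%E ->
  measurable_fun setT f -> (forall x, 0 <= f x)%E ->
  (\int[nu]_x f x = \int[mu]_x (f x * (p x)%:E))%E.
Proof.
move=> mp p0 nuE mf f0.
have mpE : measurable_fun setT (EFin \o p) by exact/measurable_EFinP.
have numu : nu `<< mu.
  apply/null_content_dominatesP => A mA A0; rewrite nuE// null_set_integral//.
  exact: measurable_funTS.
(* Its integral is the total mass of [nu], which is finite. *)
have ip : mu.-integrable setT (EFin \o p).
  apply/integrableP; split=> //.
  rewrite (eq_integral (EFin \o p)); last first.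
    by move=> x _ /=; rewrite ger0_norm.
  by rewrite -nuE// ltey_eq fin_num_measure.
have iRN := Radon_Nikodym_SigmaFinite.f_integrable numu.
rewrite -(Radon_Nikodym_SigmaFinite.change_of_variables numu f0 measurableT mf).
apply: ae_eq_integral => //.
- by apply: emeasurable_funM => //; exact: measurable_int iRN.
- exact: emeasurable_funM.
(* Two integrable functions with equal integrals over every measurable set agree almost
   everywhere. *)
- apply/ae_eqe_mul2l/integral_ae_eq => // A _ mA.
  by rewrite -Radon_Nikodym_SigmaFinite.f_integral// nuE.
Qed.

(** The expectation subtracts from the right-hand side the integral of the negative part, which is
    nonnegative. *)
Lemma expectation_le_funepos (disp : measure_display)
    (T : measurableType disp) (R : realType) (Pr : probability T R)
    (X : T -> R) :
  ('E_Pr[X] <= \int[Pr]_x (EFin \o X)^\+ x)%E.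
Proof.
by rewrite unlock integralE geeDl ?oppe_le0 ?integral_ge0//.
Qed.

(** Follows from [u <= 1 + u <= expR u], for [u] of either sign. *)
Lemma mul_expRN_le1 (R : realType) (u : R) : u * expR (- u) <= 1.
Proof.
rewrite expRN ler_pdivrMr ?expR_gt0// mul1r.
by apply: le_trans (expR_ge1Dx u); rewrite lerDr.
Qed.

(** The default [h0] varies with the point because the one in [maxaff] is its first affine
    function. *)
Lemma measurable_bigmaxr (disp : measure_display) (T : measurableType disp)
    (R : realType) (I : Type) (s : seq I) (h0 : T -> R) (h : I -> T -> R) :
  measurable_fun setT h0 -> (forall i, measurable_fun setT (h i)) ->
  measurable_fun setT (fun x => \big[Num.max/h0 x]_(i <- s) h i x).
Proof.
move=> mh0 mh; elim: s => [|i s IHs].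
  by under eq_fun do rewrite big_nil.
by under eq_fun do rewrite big_cons; exact: measurable_maxr.
Qed.

Section measurability.
Context {R : realType} {d : nat}.

Lemma measurable_dotp (u : d.-tuple R) : measurable_fun setT (dotp u).
Proof.
apply: measurable_sum => j; apply: measurable_funM => //.
exact: (@measurable_tnth _ (measurableTypeR R)).
Qed.

Lemma measurable_polytope (P : set (d.-tuple R)) : polytope P -> measurable P.
Proof.
move=> [k [c [e ->]]].
rewrite (_ : [set _ | _] =
    \bigcap_(i in [set: 'I_k]) (setT `&` [set x | dotp (c i) x <= e i])).
  apply: fin_bigcap_measurable; first exact: finite_finset.
  by move=> i _; apply: measurable_fun_le => //; exact: measurable_dotp.
by apply/seteqP; split => x h i; [split=> //; exact: h | case: (h i)].
Qed.

Lemma measurable_maxaff (m : nat) (a : 'I_m.+1 -> d.-tuple R)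
    (D : m.+1.-tuple R) : measurable_fun setT (fun x => maxaff a x D).
Proof.
have ml i : measurable_fun setT (fun x => dotp (a i) x + tnth D i).
  by apply: measurable_funD => //; exact: measurable_dotp.
exact: measurable_bigmaxr.
Qed.

Lemma measurable_weight (eps bmax : R) (g : d.-tuple R -> R) :
  measurable_fun setT g -> measurable_fun setT (weight eps bmax g).
Proof.
move=> mg; apply: measurableT_comp => //; apply: measurableT_comp => //.
by apply: measurable_funM => //; exact: measurable_funM.
Qed.

End measurability.

Section exponential_mechanism_gap.
Context {R : realType} {d : nat} {disp : measure_display}
  {T : measurableType disp}.
Context (Pr : probability T R) (X : {RV Pr >-> d.-tuple R}).
Context (P : set (d.-tuple R)) (g : d.-tuple R -> R) (eps bmax v : R).
Context (mP : measurable P) (mg : measurable_fun setT g).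

Let Z := normalizer P eps bmax g.

(** The law of [X] has total mass 1, and the indicator in the density restricts the integral to
    [P]. *)
Lemma normalizer_density (c : R) :
  has_density X (fun x => c * weight eps bmax g x * \1_P x) -> 0 <= c ->
  (c%:E * Z = 1)%E.
Proof.
move=> [_ _ dX] c0.
have := dX setT measurableT; rewrite probability_setT => ->.
rewrite /Z /normalizer -ge0_integralZl_EFin//; last 2 first.
- by move=> x _; rewrite lee_fin expR_ge0.
- by apply/measurable_EFinP/measurable_funTS; exact: measurable_weight.
rewrite integral_mkcond; apply: eq_integral => x _.
by rewrite patchE indicE; case: (x \in P); rewrite ?mulr1 ?mulr0 ?EFinM.
Qed.

(** The weight factors as [expR (- v / k) * expR (- u)] with [u := (g x - v) / k], and
    [g x - v = k * u]. *)
Lemma weight_gap_le (x : d.-tuple R) : 0 < eps -> 0 < bmax ->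
  (g x - v) * weight eps bmax g x <=
  expR (- (eps * v / (2 * bmax))) * (2 * bmax / eps).
Proof.
move=> eps0 bmax0; have k0 : 0 < 2 * bmax / eps by rewrite divr_gt0 ?mulr_gt0.
set k := 2 * bmax / eps in k0 *.
rewrite /weight.
have -> : - (eps * g x / (2 * bmax)) =
    - (eps * v / (2 * bmax)) - (g x - v) / k.
  by rewrite /k; field; rewrite !gt_eqF.
rewrite expRD mulrCA ler_pM2l ?expR_gt0//.
have -> : g x - v = k * ((g x - v) / k) by field; rewrite gt_eqF.
rewrite {2}[k * _]mulrC mulfK ?gt_eqF// -mulrA ger_pMr//.
exact: mul_expRN_le1.
Qed.

Lemma exponential_mechanism_gap : 0 < eps -> 0 < bmax -> is_min P g v ->
  (0 < Z)%E -> (Z < +oo)%E -> exponential_mechanism X P eps bmax g ->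
  ('E_Pr[fun w => (g (X w) - v)%R] <=
   Cgap P eps bmax g v 0 * (2 * bmax / eps)%:E)%E.
Proof.
move=> eps0 bmax0 [[x0 Px0 _] vmin] Z0 Zoo [c cX].
have k0 : 0 < 2 * bmax / eps by rewrite divr_gt0 ?mulr_gt0.
have [mp p0 dX] := cX.
(* At the minimizer [x0] the indicator is 1 and the weight is positive, so the sign of the density
   is that of [c]. *)
have c0 : 0 <= c.
  by have := p0 x0; rewrite indicE mem_set// mulr1 pmulr_lge0// expR_gt0.
have Zc : (Z^-1 = c%:E)%E.
  have := normalizer_density cX c0; have : Z \is a fin_num.
    by rewrite ge0_fin_numE// ltW.
  move: Z0; case: Z => // z; rewrite lte_fin => z0 _; rewrite inver gt_eqF//.
  rewrite -EFinM => -[cz].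
  by rewrite -[c]mulr1 -(mulfV (lt0r_neq0 z0)) mulrA cz mul1r.
pose h x := ((g x - v)%:E : \bar R).
have mh : measurable_fun setT h.
  by apply/measurable_EFinP; exact: measurable_funB.
have mhp : measurable_fun setT h^\+%E by exact: measurable_funepos.
(* Outside P the gap may be negative, hence the passage to positive parts. *)
rewrite (le_trans (expectation_le_funepos _ _))//.
have <- : (\int[distribution Pr X]_y h^\+ y =
    \int[Pr]_w (EFin \o (fun w => g (X w) - v)%R)^\+ w)%E.
  rewrite ge0_integral_distribution//; apply: eq_integral => w _ /=.
  by rewrite !funeposE.
rewrite (ge0_integral_density (mu := lebesgue_tuple d) mp p0)//.
rewrite /Cgap -/Z Zc.
(* As [v] is a lower bound of [g] on [P], the constraint with [gamma = 0] removes nothing. *)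
have -> : P `&` [set x | v + 0 <= g x] = P.
  by apply/seteqP; split=> [x []//|x Px]; split=> //=; rewrite addr0 vmin.
set K := expR (- (eps * v / (2 * bmax))).
(* The constants move inside the volume integral, so that both sides become integrals over the whole
   space, compared pointwise. *)
rewrite (muleAC _ _ c%:E) (muleAC _ _ (2 * bmax / eps)%:E) -!EFinM.
rewrite -ge0_integralZl_EFin//; last first.
  by rewrite mulr_ge0 ?(ltW k0)// mulr_ge0// expR_ge0.
rewrite [leRHS]integral_mkcond; apply: ge0_le_integral => //.
- by move=> x _; rewrite mule_ge0// lee_fin.
- by apply: emeasurable_funM => //; exact/measurable_EFinP.
- by apply/(measurable_restrictT _ _).1.
- move=> x _; rewrite patchE indicE mule1.
  (* Off [P] both integrands vanish; on [P] the gap is its own positive part. *)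
  case: ifPn => xP; last by rewrite mulr0 mule0.
  have gv : 0 <= g x - v by rewrite subr_ge0 vmin//; exact: set_mem.
  rewrite funeposE /h maxEge lee_fin gv -EFinM lee_fin mulr1.
  rewrite mulrCA [K * c]mulrC -[leRHS]mulrA.
  by apply: ler_wpM2l => //; exact: weight_gap_le.
Qed.

End exponential_mechanism_gap.

Theorem theorem21 (R : realType) (d m : nat) (a : 'I_m.+1 -> d.-tuple R)
    (P : set (d.-tuple R)) (hP : polytope P)
    (eps bmax : R) (heps : 0 < eps) (hbmax : 0 < bmax)
    (D : m.+1.-tuple R)
    (fopt : R) (hopt : is_min P (fun x => maxaff a x D) fopt)
    (hZ0 : (0 < normalizer P eps bmax (fun x => maxaff a x D))%E)
    (hZoo : (normalizer P eps bmax (fun x => maxaff a x D) < +oo)%E)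
    (disp : measure_display) (Omega : measurableType disp)
    (Pr : probability Omega R) (ME : {RV Pr >-> d.-tuple R})
    (hME : exponential_mechanism ME P eps bmax (fun x => maxaff a x D)) :
  ('E_Pr[fun w => (maxaff a (ME w) D - fopt)%R] <=
   Cgap P eps bmax (fun x => maxaff a x D) fopt 0 * (2 * bmax / eps)%:E)%E.
Proof.
apply: exponential_mechanism_gap => //.
- exact: measurable_polytope.
- exact: measurable_maxaff.
Qed.
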